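(* Let $\mathcal{A}$ be a finite alphabet, let $T=\mathcal{A}^{<\mathbb{N}}$ be the full tree over $\mathcal{A}$, let $Z\subseteq T$, and let $W=\bigcup_{p\in Z}[T_p]$. For $p=\langle a_1,\dots,a_n\rangle\in Z$ put $\hat p=\langle a_2,a_4,\dots,a_{2\lfloor n/2\rfloor}\rangle$, and let $\hat Z=\{\hat p: p\in Z\}$. Let $F=F(\mathcal{A})$ be the free group generated by $\mathcal{A}$, and let $\langle \hat Z\rangle\le F$ be the subgroup generated by $\hat Z$. If $$[F:\langle \hat Z\rangle]=\infty,$$ then Player 2 has a winning strategy in the game $(T,W)$.
   Context: $\mathcal{A}^{<\mathbb{N}}$ is the set of all finite sequences over $\mathcal{A}$ (including the empty sequence); its elements are called positions. A finite sequence $\langle b_1,\dots,b_m\rangle$ over $\mathcal{A}$ is identified with the element $b_1b_2\cdots b_m$ of the free group $F(\mathcal{A})$. A play is an infinite sequence in $\mathcal{A}^{\mathbb{N}}$; $[T]=\mathcal{A}^{\mathbb{N}}$ is the set of plays, and for $p\in T$, $[T_p]$ is the set of plays having $p$ as a prefix. In the game $(T,W)$ with $W\subseteq[T]$, two players alternately choose actions in $\mathcal{A}$, with Player 1 moving at positions of even length (in particular first) and Player 2 at positions of odd length, each knowing all previous moves; Player 1 wins if the resulting play lies in $W$, and otherwise Player 2 wins. A strategy of Player 1 (Player 2) is a function assigning an action to every position of even (odd) length; it is winning if every play consistent with it is won by that player.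
   Formalization: The formal theorem adds that every position p in Z has length at least 2; without this the claim is false (e.g. Z consisting of the empty position gives trivial ⟨Ẑ⟩ of infinite index, yet W is all plays and Player 1 wins). *)

(* Defs.v *)
From HB Require Import structures.
From mathcomp Require Import all_boot.
From mathcomp Require Import mathcomp_extra boolp classical_sets functions cardinality.

Set Implicit Arguments.
Unset Strict Implicit.
Unset Printing Implicit Defensive.

Local Open Scope classical_set_scope.

(* The free group on A: reduced words in the letters (a, true) = a and
   (a, false) = a^-1, multiplied by concatenation followed by reduction. *)

Definition letter_inv (A : Type) (l : A * bool) : A * bool := (l.1, ~~ l.2).

Definition reduced (A : eqType) (w : seq (A * bool)) : bool :=
  sorted (fun l m => m != letter_inv l) w.

Definition push (A : eqType) (l : A * bool) (w : seq (A * bool)) :=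
  if w is m :: w' then if m == letter_inv l then w' else l :: w else [:: l].

Definition reduced_cat (A : eqType) (u v : seq (A * bool)) := foldr (@push A) v u.

Definition word_inv (A : Type) (u : seq (A * bool)) :=
  rev (map (@letter_inv A) u).

Record free_group (A : eqType) := FreeGroup {
  free_word :> seq (A * bool);
  free_word_reduced : reduced free_word }.

HB.instance Definition _ (A : eqType) := [isSub for @free_word A].
HB.instance Definition _ (A : choiceType) := [Choice of free_group A by <:].

Section FreeGroupTheory.
Variable A : choiceType.
Implicit Types (l m : A * bool) (u v w : seq (A * bool)).

Lemma letter_invK : involutive (@letter_inv A).
Proof. by case=> a b; rewrite /letter_inv /= negbK. Qed.

Lemma letter_inv_neq l : l != letter_inv l.
Proof. by case: l => a b; rewrite xpair_eqE eqxx /=; case: b. Qed.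

Lemma push_reduced l w : reduced w -> reduced (push l w).
Proof.
case: w => [//|m w] /=; case: eqP => [_|/eqP ne] rw; first exact: path_sorted rw.
by rewrite /reduced /= ne.
Qed.

Lemma reduced_cat_reduced u v : reduced v -> reduced (reduced_cat u v).
Proof. by elim: u => //= l u IH /IH; apply: push_reduced. Qed.

Lemma pushK l w : reduced w -> push l (push (letter_inv l) w) = w.
Proof.
case: w => [|m w] /=; first by rewrite eqxx.
rewrite letter_invK; case: eqP => [->|_]; last by rewrite /= eqxx.
by case: w => [//|k w] /= /andP[/negbTE ->].
Qed.

Lemma reduced_cat_push l v w :
  reduced w -> reduced_cat (push l v) w = push l (reduced_cat v w).
Proof.
case: v => [//|m v] /= rw; case: eqP => [->|_ //].
by rewrite pushK // reduced_cat_reduced.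
Qed.

Lemma reduced_catA u v w :
  reduced w -> reduced_cat u (reduced_cat v w) = reduced_cat (reduced_cat u v) w.
Proof. by move=> rw; elim: u => //= l u ->; rewrite reduced_cat_push. Qed.

Lemma reduced_cats0 u : reduced u -> reduced_cat u [::] = u.
Proof.
elim: u => //= l u IH ru; rewrite (IH (path_sorted ru)).
by case: u ru {IH} => [//|m u] /= /andP[/negbTE ->].
Qed.

Lemma word_invK : involutive (@word_inv A).
Proof. by move=> u; rewrite /word_inv map_rev revK (mapK letter_invK). Qed.

Lemma word_inv_reduced u : reduced u -> reduced (word_inv u).
Proof.
rewrite /reduced /word_inv rev_sorted sorted_map => ru.
apply: sub_sorted ru => l m /=; apply: contraNN => /eqP.
by rewrite !letter_invK => ->.
Qed.

Lemma word_mulVg u : reduced_cat (word_inv u) u = [::].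
Proof.
elim: u => //= l u IH.
by rewrite /word_inv /= rev_cons /reduced_cat foldr_rcons /= letter_invK eqxx.
Qed.

Lemma word_mulgV u : reduced_cat u (word_inv u) = [::].
Proof. by rewrite -{1}[u]word_invK word_mulVg. Qed.

Definition free_one : free_group A := @FreeGroup A [::] isT.
Definition free_mul (x y : free_group A) : free_group A :=
  FreeGroup (reduced_cat_reduced x (free_word_reduced y)).
Definition free_inv (x : free_group A) : free_group A :=
  FreeGroup (word_inv_reduced (free_word_reduced x)).

Lemma free_mulA : associative free_mul.
Proof.
move=> x y z; apply: val_inj; apply: reduced_catA; exact: free_word_reduced.
Qed.

Lemma free_mul1 : left_id free_one free_mul.
Proof. by move=> x; apply: val_inj. Qed.

Lemma free_mulr1 : right_id free_one free_mul.
Proof.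
move=> x; apply: val_inj; apply: reduced_cats0; exact: free_word_reduced.
Qed.

Lemma free_mulV : left_inverse free_one free_inv free_mul.
Proof. by move=> x; apply: val_inj; apply: word_mulVg. Qed.

Lemma free_mulrV : right_inverse free_one free_inv free_mul.
Proof. by move=> x; apply: val_inj; apply: word_mulgV. Qed.

HB.instance Definition _ := isGroup.Build (free_group A)
  free_mulA free_mul1 free_mulr1 free_mulV free_mulrV.

End FreeGroupTheory.

Definition free_gen (A : choiceType) (a : A) : free_group A :=
  @FreeGroup A [:: (a, true)] isT.

Definition seq_elt (A : choiceType) (s : seq A) : free_group A :=
  (\prod_(a <- s) free_gen a)%g.

Definition is_subgroup (G : groupType) (H : set G) : Prop :=
  [/\ H 1%g, (forall x y, H x -> H y -> H (x * y)%g)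
    & (forall x, H x -> H x^-1%g)].

Definition generated_subgroup (G : groupType) (X : set G) : set G :=
  smallest (@is_subgroup G) X.

Definition left_cosets (G : groupType) (H : set G) : set (set G) :=
  [set [set (x * h)%g | h in H] | x in [set: G]].

Definition infinite_index (G : groupType) (H : set G) : Prop :=
  infinite_set (left_cosets H).

(* A play is x : nat -> A, with x 0 the first action of Player 1. *)

Definition plays_through (A : Type) (p : seq A) : set (nat -> A) :=
  [set x | mkseq x (size p) = p].

Definition open_payoff (A : Type) (Z : set (seq A)) : set (nat -> A) :=
  \bigcup_(p in Z) plays_through p.

Definition strategy2 (A : Type) : Type := {p : seq A | odd (size p)} -> A.

Definition consistent2 (A : Type) (sigma : strategy2 A) (x : nat -> A) : Prop :=
  forall p : {p : seq A | odd (size p)},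
    plays_through (sval p) x -> x (size (sval p)) = sigma p.

Definition winning2 (A : Type) (W : set (nat -> A)) (sigma : strategy2 A) : Prop :=
  forall x, consistent2 sigma x -> ~ W x.

(* <a_1, ..., a_n>  |->  <a_2, a_4, ..., a_(2 * floor (n / 2))>, which is empty
   when n <= 1.  A position of length at most 1 therefore adds nothing to the
   generated subgroup, although it lets Player 1 win at once. *)
Fixpoint even_entries (A : Type) (p : seq A) : seq A :=
  if p is _ :: b :: q then b :: even_entries q else [::].

(* Main.v *)
Require Import Defs.
From HB Require Import structures.
From mathcomp Require Import all_boot.
From mathcomp Require Import mathcomp_extra boolp classical_sets functions cardinality.

Set Implicit Arguments.
Unset Strict Implicit.
Unset Printing Implicit Defensive.

Local Open Scope classical_set_scope.

(** Let [H] be the subgroup generated by the words of Player 2.  It suffices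
    to find an infinite word over [A] none of whose nonempty prefixes lies in
    [H]: Player 2 plays its letters, ignoring Player 1.  If there were no such
    word, then by König's lemma some [N] would be such that every word of
    length [N] has a nonempty prefix in [H].  Stripping such prefixes
    repeatedly, every positive word lies in [H u] for a word [u] shorter than
    [N], and every positive word [w] has an extension [w a^i] in [H] for each
    letter [a].  The latter shows that the union of the cosets [u^-1 H], with
    [u] positive, is stable under left multiplication by letters and their
    inverses, so it is the whole group; the former shows that finitely many [u]
    suffice.  Hence [H] would have finite index. *)

Lemma generated_subgroup_is_subgroup (G : groupType) (X : set G) :
  is_subgroup (generated_subgroup X).
Proof.
split=> [K [[]] //|x y Hx Hy K KX|x Hx K KX]; have [[_ KM KV] _] := KX.
- exact: KM (Hx _ KX) (Hy _ KX).
- exact: KV (Hx _ KX).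
Qed.

(** Call a word good if it has extensions of every length in [P]. Finiteness of [A] gives each good
    word a good one-letter extension; iterate from the empty word. *)
Lemma konig (A : finType) (P : set (seq A)) :
  (forall u v, P (u ++ v) -> P u) ->
  (forall n, exists2 w, size w = n & P w) ->
  exists y : nat -> A, forall n, P (mkseq y n).
Proof.
move=> Pprefix Punbounded.
pose good w := forall n, exists2 v, size v = n & P (w ++ v).
have goodS w : good w -> exists a, good (rcons w a).
  move=> gw; apply: contrapT => /forallNP ngood.
  have /choice[b bP] a : exists n, forall v, size v = n -> ~ P (rcons w a ++ v).
    have /existsNP[n nP] := ngood a.
    by exists n => v sv Pv; apply: nP; exists v.
  (* Each letter [a] fails at length [b a]. An extension longer than every [b a] starts with some
     [a]; cutting it [b a] letters later contradicts that failure. *)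
  have [[//|a v] [sv] Pv] := gw (\max_a b a).+1.
  apply: (bP a (take (b a) v)).
    by rewrite size_takel // sv; apply: leq_bigmax.
  by apply: (Pprefix _ (drop (b a) v)); rewrite -catA cat_take_drop cat_rcons.
(* [a0] is the default successor letter of words that are not good. *)
have [[//|a0 _] _ _] := Punbounded 1.
have /choice[f fP] w : exists a, good w -> good (rcons w a).
  by have [/goodS[a ?]|] := pselect (good w); [exists a|exists a0].
pose W := fix W n := if n is m.+1 then rcons (W m) (f (W m)) else [::].
exists (fun n => f (W n)) => n.
have -> : mkseq (fun n => f (W n)) n = W n.
  by elim: n => // n IH; rewrite mkseqS IH.
have gW : good (W n) by elim: n => [|n /fP].
by have [[|//] _] := gW 0; rewrite cats0.
Qed.

Section PositiveWords.
Variable A : choiceType.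
Implicit Types (a : A) (w : seq A).

Lemma seq_elt_cat w1 w2 : seq_elt (w1 ++ w2) = (seq_elt w1 * seq_elt w2)%g.
Proof. by rewrite /seq_elt big_cat. Qed.

Lemma seq_elt1 a : seq_elt [:: a] = free_gen a.
Proof. by rewrite /seq_elt big_seq1. Qed.

Lemma free_group_ind_letters (P : set (free_group A)) :
  P 1%g ->
  (forall a g, P g -> P (free_gen a * g)%g) ->
  (forall a g, P g -> P ((free_gen a)^-1 * g)%g) ->
  forall g, P g.
Proof.
move=> P1 PM PV [w]; elim: w => [|[a b] w IH] rw.
  by have -> : FreeGroup rw = 1%g by apply: val_inj.
have rw' : reduced w := path_sorted rw.
(* In a reduced word the first letter cancels nothing, so the word is that letter times its tail. *)
have pushE : push (a, b) w = (a, b) :: w.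
  by case: w rw {IH rw'} => //= m w /andP[/negPf->].
case: b rw pushE => rw pushE.
- have -> : FreeGroup rw = (free_gen a * FreeGroup rw')%g.
    by apply: val_inj; rewrite /= pushE.
  exact: PM (IH rw').
- have -> : FreeGroup rw = ((free_gen a)^-1 * FreeGroup rw')%g.
    by apply: val_inj; rewrite /= pushE.
  exact: PV (IH rw').
Qed.

Variable H : set (free_group A).
Hypothesis subH : is_subgroup H.
Variable N : nat.
Hypothesis hitH : forall w, size w = N ->
  exists2 k, 0 < k <= N & H (seq_elt (take k w)).

Let H1 : H 1%g. Proof. by case: subH. Qed.
Let HM x y : H x -> H y -> H (x * y)%g. Proof. by case: subH => _ HM _; apply: HM. Qed.
Let HV x : H x -> H (x^-1)%g. Proof. by case: subH => _ _ HV; apply: HV. Qed.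

(** While at least [N] letters remain, [hitH] removes a nonempty prefix lying in [H]. *)
Lemma strip_prefix w :
  exists2 k, k <= size w < k + N & H (seq_elt (take k w)).
Proof.
have [n] := ubnP (size w); elim: n w => // n IH w wn.
have [wN|Nw] := ltnP (size w) N.
  by exists 0; rewrite ?take0 /seq_elt ?big_nil.
have [k /andP[k0 kN] Hk] := hitH (size_takel Nw).
rewrite take_takel // in Hk.
have kw := leq_trans kN Nw.
have [|j /andP[jw wj] Hj] := IH (drop k w).
  rewrite size_drop; apply: leq_trans (_ : _ < size w) wn.
  by rewrite ltn_subrL k0 (leq_trans k0).
rewrite size_drop in jw wj.
exists (k + j); last by rewrite takeD seq_elt_cat; apply: HM.
by rewrite -leq_subRL // jw -addnA -ltn_subLR.
Qed.

(** Stripping [w] followed by [N] copies of [a] leaves fewer than [N] letters, so the stripped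
    prefix ends inside the block of [a]. *)
Lemma extend_by_letter w a : exists i, H (seq_elt (w ++ nseq i a)).
Proof.
have [k] := strip_prefix (w ++ nseq N a).
rewrite size_cat size_nseq ltn_add2r => /andP[kN wk].
rewrite take_cat ltnNge (ltnW wk) /= take_nseq; first by exists (k - size w).
by rewrite leq_subLR.
Qed.

Lemma positive_translate_in_subgroup g : exists w, H (seq_elt w * g)%g.
Proof.
move: g; apply: free_group_ind_letters => [|a g [w Hw]|a g [w Hw]].
- by exists [::]; rewrite /seq_elt big_nil mulg1.
- have [i Hi] := extend_by_letter w a.
  have [j Hj] := extend_by_letter (nseq i.+1 a) a.
  exists (nseq j a).
  (* [a^j a g] is the product of [a^(i+1+j)], [(w a^i)^-1] and [w g]. *)
  have E : seq_elt (nseq i.+1 a ++ nseq j a) =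
      (seq_elt (nseq j a) * free_gen a * seq_elt (nseq i a))%g.
    rewrite -seq_elt1 -!seq_elt_cat -catA -[[:: a] ++ _]/(nseq i.+1 a).
    by rewrite -!nseqD addnC.
  have := HM (HM Hj (HV Hi)) Hw.
  by rewrite E seq_elt_cat invgM !mulgA mulgK mulgVK.
- exists (rcons w a).
  by rewrite -cats1 seq_elt_cat seq_elt1 -mulgA mulVKg.
Qed.

End PositiveWords.

Lemma finite_index_of_hitting (A : finType) (H : set (free_group A)) N :
  is_subgroup H ->
  (forall w : seq A, size w = N ->
    exists2 k, 0 < k <= N & H (seq_elt (take k w))) ->
  finite_set (left_cosets H).
Proof.
move=> subH hitH; have [_ HM HV] := subH.
pose coset (u : N.-bseq A) := [set ((seq_elt u)^-1 * h)%g | h in H].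
apply: (@sub_finite_set _ _ (coset @` setT)); last first.
  by apply: finite_image; apply: finite_finset.
move=> _ [g _ <-].
have [w Hw] := positive_translate_in_subgroup subH hitH g.
have [k /andP[kw wk] Hk] := strip_prefix subH hitH w.
have su : size (drop k w) <= N by rewrite size_drop leq_subLR ltnW.
(* With [u] the unstripped tail of [w], [u g] lies in [H], whence [g H = u^-1 H]. *)
have Hu : H (seq_elt (drop k w) * g)%g.
  have := HM _ _ (HV _ Hk) Hw.
  by rewrite -{2}(cat_take_drop k w) seq_elt_cat -mulgA mulKg.
exists (Bseq su) => //; apply/seteqP; split=> _ [h Hh <-] /=.
- exists ((seq_elt (drop k w) * g)^-1 * h)%g; first by apply: HM => //; apply: HV.
  by rewrite invgM !mulgA mulgV mul1g.
- exists (seq_elt (drop k w) * g * h)%g; first exact: HM.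
  by rewrite -mulgA mulKg.
Qed.

Lemma exists_avoiding_word (A : finType) (H : set (free_group A)) :
  is_subgroup H -> infinite_index H ->
  exists y : nat -> A, forall n, 0 < n -> ~ H (seq_elt (mkseq y n)).
Proof.
move=> subH infH.
pose avoids (w : seq A) :=
  forall k, 0 < k <= size w -> ~ H (seq_elt (take k w)).
have [u v uvP k /andP[k0 ku]||y yP] := @konig A avoids; first 1 last.
- move=> N; apply: contrapT => noavoid; apply: infH.
  apply: (finite_index_of_hitting (N := N)) => // w wN.
  apply: contrapT => nohit; apply: noavoid; exists w => // k.
  by rewrite wN => kN Hk; apply: nohit; exists k.
- exists y => n n0; have := yP n n.
  by rewrite size_mkseq n0 leqnn take_oversize ?size_mkseq //; apply.
- have := uvP k.
  by rewrite takel_cat // size_cat k0 (leq_trans ku) ?leq_addr //; apply.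
Qed.

Lemma even_entries_mkseq (A : Type) (x : nat -> A) n :
  even_entries (mkseq x n) = mkseq (fun k => x k.*2.+1) n./2.
Proof.
have [m] := ubnP n; elim: m n x => // m IH [|[|n]] x //= nm.
rewrite /mkseq /=; congr (_ :: _).
(* Dropping two entries of the play shifts [x] by 2. *)
rewrite (iotaDl 2 0) (iotaDl 1 0) -!map_comp.
exact: (IH n (x \o addn 2) (ltnW nm)).
Qed.

Theorem theorem2p8 (A : finType) (Z : set (seq A))
    (hZ : forall p : seq A, Z p -> (2 <= size p)%N)
    (hindex : infinite_index
       (generated_subgroup (@seq_elt A @` (@even_entries A @` Z)))) :
  exists sigma : strategy2 A, winning2 (open_payoff Z) sigma.
Proof.
have [y yP] := exists_avoiding_word (generated_subgroup_is_subgroup _) hindex.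
(* At a position of length [2k+1] Player 2 plays [y k]. *)
exists (fun p => y (size (sval p))./2) => x xy [p Zp xp].
have xyq (q : seq A) :
    plays_through q x -> odd (size q) -> x (size q) = y (size q)./2.
  by move=> xq oq; apply: (xy (exist (fun r : seq A => odd (size r)) q oq)).
have xodd k : x k.*2.+1 = y k.
  have := xyq (mkseq x k.*2.+1); rewrite /plays_through !size_mkseq => -> //.
  - by rewrite (half_bit_double k true).
  - by rewrite oddS odd_double.
(* The even entries of [p] form a prefix of [y], nonempty because [p] has length at least 2, and
   they give a generator of the subgroup. *)
apply: (yP (size p)./2); first by rewrite half_gt0; apply: hZ.
apply: sub_gen_smallest; exists (even_entries p); first by exists p.
by rewrite -[in LHS]xp even_entries_mkseq (eq_mkseq xodd).
Qed.
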